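(* Let $d$ be an even positive integer, and let $H_d(k)$ denote the number of $d\times d$ magic squares with linear sums equal to $k$. Then $$\sum_{m=0}^{N}(-1)^{N+m}\binom{d^2-2d+3}{N-m}H_d(dm)=0,$$ where $N:=\lceil (d-1)^2/2\rceil$.
   Context: A magic square with linear sums $k$ is a $d\times d$ matrix of non-negative integers all of whose row sums and column sums equal $k$ (no condition on diagonals). *)

(* Defs.v *)
From mathcomp Require Import all_boot all_order all_algebra.

Set Implicit Arguments.
Unset Strict Implicit.
Unset Printing Implicit Defensive.

Definition magic_square (d k : nat) (A : 'M[nat]_d) : bool :=
  [forall i, \sum_(j < d) A i j == k] && [forall j, \sum_(i < d) A i j == k].

(* The entries of a magic square with linear sums k are at most k, so counting
   the ones with entries in 'I_k.+1 counts all of them: see magic_square_bounded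
   below. This makes the number of magic squares a finite cardinal. *)
Definition magic_count (d k : nat) : nat :=
  #|[set A : 'M['I_k.+1]_d | magic_square k (map_mx val A)]|.

Lemma magic_square_bounded (d k : nat) (A : 'M[nat]_d) :
  magic_square k A -> exists! B : 'M['I_k.+1]_d, map_mx val B = A.
Proof.
case/andP=> /forallP Hr _.
have le_k i j : A i j <= k.
  by rewrite -(eqP (Hr i)) (bigD1 j) //= leq_addr.
exists (\matrix_(i, j) inord (A i j))%R; split=> [|B <-].
  by apply/matrixP=> i j; rewrite !mxE /= inordK // ltnS.
by apply/matrixP=> i j; rewrite !mxE /= inord_val.
Qed.

(* Main.v *)
Require Import Defs.
From HB Require Import structures.
From mathcomp Require Import all_boot all_order all_algebra all_fingroup.
From mathcomp Require Import ring lra zify.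

Import Order.TTheory GRing.Theory Num.Theory.

Set Implicit Arguments.
Unset Strict Implicit.
Unset Printing Implicit Defensive.

(* Every nonnegative matrix with constant line sums decomposes greedily into
   permutation matrices: subtract a chosen permutation of its support as often as
   possible and repeat.  The sets of permutations that occur are the simplices of
   a unimodular triangulation of the cone over the Birkhoff polytope.  Fix a
   positive [v] avoiding the spans of all sets of permutations that do not span.
   Decomposing [A + e v] for small [e > 0] assigns to every magic square [A] a
   full-dimensional simplex in which the coefficients [c_s] of [A] are natural
   numbers, nonzero where the coordinate of [v] is negative.  Decomposing [A - e v]
   does the same for squares with positive entries, with the opposite sign
   condition.  With [n = d - 1] the simplices have [n^2 + 1] vertices, so both
   counts are sums of binomial coefficients, and comparing them shows that
   [H_d] is a polynomial [P] of degree at most [n^2] with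
   [P(-k-d) = (-1)^(n^2) P(k)].  For even [d] the function [m |-> P(d m)] is thus
   odd about [-1/2]; its finite difference of order [n^2 + 2 = 2N + 1] vanishes,
   and pairing the terms [m] and [-1-m] shows that it is twice the sum in
   question, up to sign. *)

(** * Greedy decomposition into permutation matrices *)

(* Halmos-Vaughan: split along a tight proper subset if there is one, otherwise
   match any element arbitrarily. *)
Lemma hall (I J : finType) (j0 : J) (N : I -> {set J}) (A : {set I}) :
  (forall B : {set I}, B \subset A -> #|B| <= #|\bigcup_(i in B) N i|) ->
  exists f : I -> J, {in A &, injective f} /\ {in A, forall i, f i \in N i}.
Proof.
have [n] := ubnP #|A|; elim: n => // n IHn in A N *; rewrite ltnS => leAn hallA.
have [->|[a aA]] := set_0Vmem A.
  by exists (fun=> j0); split=> i; rewrite inE.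
case: (boolP [exists B : {set I}, [&& B != set0, B \proper A &
                #|\bigcup_(i in B) N i| == #|B|]]).
  case/existsP=> B /and3P[Bn0 ltBA /eqP tightB].
  have sBA := proper_sub ltBA.
  set NB := \bigcup_(i in B) N i in tightB.
  have [||f1 [inj1 in1]] := IHn B N.
  - exact: leq_trans (proper_card ltBA) leAn.
  - by move=> C sCB; apply: hallA; apply: subset_trans sBA.
  have [||f2 [inj2 in2]] := IHn (A :\: B) (fun i => N i :\: NB).
  - apply: leq_trans leAn; rewrite -(cardsID B A) (setIidPr sBA).
    by rewrite -[X in X < _]add0n ltn_add2r card_gt0.
  - move=> C; rewrite subsetD => /andP[sCA dCB].
    rewrite -(leq_add2r #|B|) -cardsUI (eqP (_ : #|C :&: B| == 0)) ?addn0; last first.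
      by rewrite cards_eq0 setI_eq0.
    have /hallA/leq_trans-> // : C :|: B \subset A by rewrite subUset sCA.
    rewrite -tightB; apply: leq_trans (leq_card_setU _ _).
    apply/subset_leq_card/bigcupsP=> i; rewrite inE => /orP[iC|iB].
      apply/subsetP=> j jN; rewrite inE.
      have [jNB|jNB] := boolP (j \in NB); first by rewrite orbT.
      by rewrite orbF; apply/bigcupP; exists i => //; rewrite inE jNB.
    by apply: subset_trans (subsetUr _ _); apply: bigcup_sup.
  have notB i : i \in A -> i \notin B -> i \in A :\: B by rewrite inE => -> ->.
  exists (fun i => if i \in B then f1 i else f2 i); split.
    have sep i k : i \in B -> k \in A -> k \notin B -> f1 i = f2 k -> False.
      move=> iB kA kB e; have := in2 k (notB _ kA kB).
      rewrite -e inE => /andP[/negP[]]; apply/bigcupP; exists i => //.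
      exact: in1.
    move=> i k iA kA; case: ifP => iB; case: ifP => kB.
    - exact: inj1.
    - by move=> /(sep _ _ iB kA (negbT kB)).
    - by move/esym => /(sep _ _ kB iA (negbT iB)).
    - by apply: inj2; apply: notB => //; rewrite ?iB ?kB.
  move=> i iA; case: ifP => iB; first exact: in1.
  by have := in2 i (notB _ iA (negbT iB)); rewrite inE => /andP[].
rewrite negb_exists => /forallP slack.
have /set0Pn[j jNa] : N a != set0.
  by have := hallA [set a]; rewrite big_set1 sub1set cards1 card_gt0; apply.
have [||f [injf inf]] := IHn (A :\ a) (fun i => N i :\ j).
- by move: leAn; rewrite (cardsD1 a A) aA.
- move=> C sC; have [->|Cn0] := eqVneq C set0; first by rewrite cards0.
  have ltCA : C \proper A by apply: sub_proper_trans sC (properD1 aA).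
  have := slack C; rewrite Cn0 ltCA /= => neqC.
  have ltC : #|C| < #|\bigcup_(i in C) N i|.
    by rewrite ltn_neqAle eq_sym neqC hallA // proper_sub.
  rewrite -ltnS; apply: leq_trans ltC _.
  have -> : \bigcup_(i in C) (N i :\ j) = (\bigcup_(i in C) N i) :\ j.
    apply/setP=> x; rewrite !inE; apply/bigcupP/andP.
      by case=> i iC; rewrite !inE => /andP[-> xi]; split=> //; apply/bigcupP; exists i.
    by case=> xj /bigcupP[i iC xi]; exists i => //; rewrite !inE xj.
  by rewrite (cardsD1 j (\bigcup_(i in C) N i)) -add1n leq_add2r leq_b1.
have inN i : i \in A -> i != a -> i \in A :\ a by rewrite !inE => -> ->.
exists (fun i => if i == a then j else f i); split.
  have sep k : k \in A -> k != a -> j = f k -> False.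
    by move=> kA ka e; have := inf k (inN _ kA ka); rewrite -e !inE eqxx.
  move=> i k iA kA; case: (eqVneq i a) => [->|ia]; case: (eqVneq k a) => [->|ka] //.
  - by move=> /(sep _ kA ka).
  - by move/esym => /(sep _ iA ia).
  - by apply: injf; apply: inN.
move=> i iA; case: (eqVneq i a) => [-> //|ia].
by have := inf i (inN _ iA ia); rewrite inE => /andP[].
Qed.

Local Open Scope ring_scope.

Definition line_sums (d : nat) (k : rat) (A : 'M[rat]_d) : Prop :=
  (forall i, \sum_j A i j = k) /\ (forall j, \sum_i A i j = k).

(** Hall's condition by double counting: the rows in [B] have total mass [k * #|B|], all of it in
    the columns of [NB], whose whole mass is [k * #|NB|]. *)
Lemma birkhoff_perm (d : nat) (k : rat) (A : 'M[rat]_d) :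
  (forall i j, 0 <= A i j) -> line_sums k A -> 0 < k ->
  exists s : 'S_d, forall i, 0 < A i (s i).
Proof.
move=> A_ge0 [rowA colA] k_gt0.
case: d A A_ge0 rowA colA => [|n] A A_ge0 rowA colA.
  by exists 1%g; case.
pose N i := [set j | 0 < A i j].
have [|f [injf inf]] := @hall _ _ ord0 N setT.
  move=> B _; set NB := \bigcup_(i in B) N i.
  suff : k * #|B|%:R <= k * #|NB|%:R by rewrite ler_pM2l // ler_nat.
  rewrite -!sum1_card !natr_sum !mulr_sumr.
  rewrite (eq_bigr (fun i => \sum_(j in NB) A i j)) => [|i iB]; last first.
    rewrite mulr1 -(rowA i) (bigID (mem NB)) /= [X in _ + X]big1 ?addr0 // => j jNB.
    apply/eqP; rewrite eq_le A_ge0 andbT leNgt; apply: contra jNB => Aij.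
    by apply/bigcupP; exists i; rewrite ?inE.
  rewrite exchange_big; apply: ler_sum => j _.
  rewrite mulr1 -(colA j) [leRHS](bigID (mem B)) /= lerDl.
  by apply: sumr_ge0.
have injf' : injective f by move=> i j; apply: injf; rewrite inE.
exists (perm injf') => i; rewrite permE.
by have := inf i; rewrite !inE; apply.
Qed.

Definition pgraph (d : nat) (s : 'S_d) : {set 'I_d * 'I_d} := [set e | s e.1 == e.2].

Definition psupp (d : nat) (T : {set 'S_d}) : {set 'I_d * 'I_d} :=
  \bigcup_(s in T) pgraph s.

(** Which permutation is picked does not matter; what matters is that it is a function of the
    support alone, so that two decompositions of the same matrix start with the same permutation. *)
Definition lead (d : nat) (S : {set 'I_d * 'I_d}) : option 'S_d :=
  [pick s | pgraph s \subset S].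

Fixpoint simplex_rec (d n : nat) (T : {set 'S_d}) : bool :=
  if n is n'.+1 then
    if lead (psupp T) is Some s then
      [&& s \in T, ~~ (pgraph s \subset psupp (T :\ s)) & simplex_rec n' (T :\ s)]
    else false
  else T == set0.

(* A set is a simplex if its greedy order exists: the leading permutation of its
   support belongs to it and uses an entry that no other element uses. *)
Definition simplex (d : nat) (T : {set 'S_d}) : bool := simplex_rec #|T| T.

Lemma simplex0 (d : nat) : simplex (set0 : {set 'S_d}).
Proof. by rewrite /simplex cards0 /=. Qed.

Lemma simplexP (d : nat) (T : {set 'S_d}) : T != set0 ->
  reflect (exists s, [/\ lead (psupp T) = Some s, s \in T,
                         ~~ (pgraph s \subset psupp (T :\ s)) & simplex (T :\ s)])
          (simplex T).
Proof.
rewrite -card_gt0 /simplex; case En: #|T| => [//|n] _ /=.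
have En' s : s \in T -> n = #|T :\ s| by move=> sT; move: En; rewrite (cardsD1 s) sT => -[].
apply: (iffP idP) => [|[s [-> sT -> sim]]]; last by rewrite sT (En' s).
case: lead => // s /and3P[sT nsub sim]; exists s; split=> //.
by rewrite /simplex -(En' s).
Qed.

Definition pcomb (d : nat) (T : {set 'S_d}) (x : 'S_d -> rat) : 'M[rat]_d :=
  \sum_(s in T) x s *: perm_mx s.

Lemma pcombE (d : nat) (T : {set 'S_d}) x i j :
  pcomb T x i j = \sum_(s in T | s i == j) x s.
Proof.
rewrite summxE big_mkcondr; apply: eq_bigr => s _.
by rewrite !mxE; case: eqP => _; rewrite ?mulr1 ?mulr0.
Qed.

Lemma pcombD1 (d : nat) (T : {set 'S_d}) s x : s \in T ->
  pcomb T x = x s *: perm_mx s + pcomb (T :\ s) x.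
Proof. exact: big_setD1. Qed.

Lemma line_sums_pcomb (d : nat) (T : {set 'S_d}) x :
  line_sums (\sum_(s in T) x s) (pcomb T x).
Proof.
split=> i; rewrite /pcomb; under eq_bigr do rewrite summxE;
  rewrite exchange_big; apply: eq_bigr => s _.
- rewrite (bigD1 (s i)) //= big1 ?addr0 => [|j /negPf ne]; rewrite !mxE ?eqxx ?mulr1 //.
  by rewrite eq_sym ne mulr0.
- rewrite (bigD1 (s^-1 i)%g) //= big1 ?addr0 => [|j ne]; rewrite !mxE ?permKV ?eqxx ?mulr1 //.
  by rewrite (negPf (_ : s j != i)) ?mulr0 //; apply: contraNneq ne => <-; rewrite permK.
Qed.

Lemma pcomb_ge0 (d : nat) (T : {set 'S_d}) x i j :
  {in T, forall s, 0 < x s} -> 0 <= pcomb T x i j.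
Proof. by move=> x0; rewrite pcombE sumr_ge0 // => s /andP[/x0/ltW]. Qed.

Lemma pcomb_gt0 (d : nat) (T : {set 'S_d}) x i j :
  {in T, forall s, 0 < x s} -> (0 < pcomb T x i j) = ((i, j) \in psupp T).
Proof.
move=> x0; rewrite pcombE; apply/idP/bigcupP => [|[s sT]].
  have [s /andP[sT sij] _|none] := pickP (fun s => (s \in T) && (s i == j)).
    by exists s; rewrite ?inE.
  by rewrite big_pred0 ?ltxx.
rewrite inE /= => sij; rewrite (bigD1 s) ?sT //= ltr_wpDr ?x0 //.
by apply: sumr_ge0 => u /andP[/andP[/x0/ltW]].
Qed.

Lemma psupp_eq0 (n : nat) (T : {set 'S_n.+1}) : (psupp T == set0) = (T == set0).
Proof.
apply/eqP/eqP => [e|->]; last by rewrite /psupp big_set0.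
have [//|[s sT]] := set_0Vmem T; have : (ord0, s ord0) \in psupp T by apply/bigcupP;
  exists s; rewrite ?inE /=.
by rewrite e inE.
Qed.

Lemma leadP (d : nat) (S : {set 'I_d * 'I_d}) s : lead S = Some s -> pgraph s \subset S.
Proof. by rewrite /lead; case: pickP => // u sub [<-]. Qed.

(** Removing the leading permutation as often as possible empties an entry of its graph, so the
    support shrinks. No later permutation uses the emptied entry, which is what [simplex] asks
    for. *)
Lemma greedy_exists (n : nat) (k : rat) (A : 'M[rat]_n.+1) :
  (forall i j, 0 <= A i j) -> line_sums k A ->
  exists T x, [/\ simplex T, {in T, forall s, 0 < x s} & A = pcomb T x].
Proof.
pose supp (A : 'M[rat]_n.+1) := [set e | 0 < A e.1 e.2].
have [m] := ubnP #|supp A|; elim: m => // m IHm in k A *; rewrite ltnS => leAm A_ge0 sumA.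
have [k_le0|k_gt0] := leP k 0.
  exists set0, (fun=> 0); split; [exact: simplex0 | by move=> s; rewrite inE |].
  rewrite /pcomb big_set0; apply/matrixP=> i j; rewrite mxE.
  apply/eqP; rewrite eq_le A_ge0 andbT; apply: le_trans k_le0.
  by rewrite -(sumA.1 i) (bigD1 j) //= lerDl sumr_ge0.
have [s leadA] : exists s, lead (supp A) = Some s.
  have [s sA] := birkhoff_perm A_ge0 sumA k_gt0.
  rewrite /lead; case: pickP => [u _|/(_ s)/subsetP[]]; first by exists u.
  by move=> [i j]; rewrite !inE /= => /eqP<-.
have sA i : 0 < A i (s i).
  by have /subsetP/(_ (i, s i)) := leadP leadA; rewrite !inE /= eqxx; apply.
have [i0 _ min_i0] := @Order.TotalTheory.arg_minP _ _ 'I_n.+1 ord0 predT (fun i => A i (s i)) isT.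
set c := A i0 (s i0) in min_i0; pose A' := A - c *: perm_mx s.
have A'E i j : A' i j = A i j - (if s i == j then c else 0).
  by rewrite !mxE; case: eqP => _; rewrite ?mulr1 ?mulr0.
have le_supp : supp A' \subset supp A.
  apply/subsetP=> -[i j]; rewrite !inE /= A'E.
  by case: ifP => [/eqP<- //|_]; rewrite subr0.
have cmp : line_sums (k - c) A'.
  have := line_sums_pcomb [set s] (fun=> c); rewrite /pcomb !big_set1 => -[rs cs].
  split=> i; under eq_bigr do rewrite !mxE; rewrite big_split sumrN /=.
    by rewrite (sumA.1 i); congr (_ - _); rewrite -[RHS](rs i); apply: eq_bigr => j _;
      rewrite !mxE.
  by rewrite (sumA.2 i); congr (_ - _); rewrite -[RHS](cs i); apply: eq_bigr => j _; rewrite !mxE.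
have notA' : (i0, s i0) \notin supp A' by rewrite inE /= A'E eqxx subrr ltxx.
have [||T [x [simT x0 defA']]] := IHm (k - c) A' _ _ cmp.
- apply: leq_trans leAm; apply: proper_card; rewrite properE le_supp /=.
  by apply/subsetPn; exists (i0, s i0) => //; rewrite inE /= sA.
- move=> i j; rewrite A'E; case: ifP => [/eqP<-|_]; last by rewrite subr0.
  by rewrite subr_ge0 min_i0.
have suppA' : psupp T = supp A'.
  by apply/setP=> -[i j]; rewrite inE defA' pcomb_gt0.
have gs : (i0, s i0) \in pgraph s by rewrite inE.
have sT : s \notin T.
  by apply: contra notA' => sT; rewrite -suppA'; apply/bigcupP; exists s.
have TE : (s |: T) :\ s = T by rewrite setU1K.
pose y u := if u == s then c else x u.
have yT u : u \in T -> y u = x u by rewrite /y; case: eqP => // ->; rewrite (negPf sT).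
have y0 : {in s |: T, forall u, 0 < y u}.
  by move=> u; rewrite in_setU1 => /orP[/eqP->|uT]; [rewrite /y eqxx;
    apply: sA | rewrite yT // x0].
have defA : A = pcomb (s |: T) y.
  rewrite (pcombD1 _ (setU11 s T)) TE /y eqxx -/y.
  have -> : pcomb T y = A' by rewrite defA'; apply: eq_bigr => u /yT->.
  by rewrite addrC subrK.
exists (s |: T), y; split=> //; apply/simplexP.
  by apply/set0Pn; exists s; rewrite setU11.
exists s; rewrite TE setU11; split=> //.
  by rewrite -leadA; congr lead; apply/setP=> -[i j]; rewrite -(pcomb_gt0 _ _ y0) -defA inE.
by rewrite suppA'; apply/subsetPn; exists (i0, s i0).
Qed.

(** Together with [pcomb_head]: the leading coefficient is the minimum of the matrix along the graph
    of the leading permutation, so the matrix determines it. *)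
Lemma pcomb_head_le (d : nat) (T : {set 'S_d}) x s i : s \in T ->
  {in T, forall u, 0 < x u} -> x s <= pcomb T x i (s i).
Proof.
move=> sT x0; rewrite (pcombD1 _ sT) !mxE eqxx mulr1 lerDl pcomb_ge0 // => u.
by case/setD1P=> _ /x0.
Qed.

Lemma pcomb_head (d : nat) (T : {set 'S_d}) x s : s \in T ->
  ~~ (pgraph s \subset psupp (T :\ s)) -> exists i, x s = pcomb T x i (s i).
Proof.
move=> sT /subsetPn[[i j]]; rewrite inE /= => /eqP<- nsub.
exists i; rewrite (pcombD1 _ sT) !mxE eqxx mulr1 pcombE big_pred0 ?addr0 // => u.
by apply: contraNF nsub => /andP[uT ui]; apply/bigcupP; exists u => //; rewrite inE.
Qed.

(** The matrix determines its support, the support its leading permutation, and then the matrix its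
    coefficient; peeling this term off leaves smaller simplices. *)
Lemma pcomb_inj (n : nat) (T T' : {set 'S_n.+1}) x x' :
  simplex T -> simplex T' ->
  {in T, forall s, 0 < x s} -> {in T', forall s, 0 < x' s} ->
  pcomb T x = pcomb T' x' -> T = T' /\ {in T, x =1 x'}.
Proof.
have [m] := ubnP #|T|; elim: m => // m IHm in T T' *; rewrite ltnS => leTm.
move=> simT simT' x0 x0' e.
have eqsupp : psupp T = psupp T'.
  by apply/setP=> -[i j]; rewrite -(pcomb_gt0 _ _ x0) e pcomb_gt0.
have [T0|Tn0] := eqVneq T set0.
  split; last by move=> s; rewrite T0 inE.
  by apply/eqP; rewrite T0 eq_sym -psupp_eq0 -eqsupp psupp_eq0 T0.
have Tn0' : T' != set0 by rewrite -psupp_eq0 -eqsupp psupp_eq0.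
have [s [leadT sT nsub sim]] := simplexP Tn0 simT.
have [s' [leadT' sT' nsub' sim']] := simplexP Tn0' simT'.
have ss' : s' = s by move: leadT; rewrite eqsupp leadT' => -[].
rewrite {}ss' in leadT' sT' nsub' sim'.
have xs : x s = x' s.
  apply/eqP; rewrite eq_le; apply/andP; split.
    by have [i ->] := pcomb_head x' sT' nsub'; rewrite -e pcomb_head_le.
  by have [i ->] := pcomb_head x sT nsub; rewrite e pcomb_head_le.
have [|||| eT ex] := IHm (T :\ s) (T' :\ s) _ sim sim'.
- by apply: leq_trans leTm; rewrite [X in (_ < X)%N](cardsD1 s) sT.
- by move=> u /setD1P[_ /x0].
- by move=> u /setD1P[_ /x0'].
- by apply: (addrI (x s *: perm_mx s)); rewrite -pcombD1 // xs -pcombD1.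
split; first by rewrite -(setD1K sT) eT setD1K.
by move=> u uT; have [-> //|us] := eqVneq u s; apply: ex; rewrite !inE us.
Qed.

(* Used with [Z] equal to [0] (linear independence) and to the integers
   (unimodularity). *)
Lemma simplex_coef_closed (d : nat) (T : {set 'S_d}) x (Z : rat -> Prop) :
  (forall a b, Z a -> Z b -> Z (a - b)) -> simplex T ->
  (forall i j, Z (pcomb T x i j)) -> {in T, forall s, Z (x s)}.
Proof.
have [m] := ubnP #|T|; elim: m => // m IHm in T *; rewrite ltnS => leTm.
move=> ZB simT ZT u uT; have Tn0 : T != set0 by apply/set0Pn; exists u.
have [s [_ sT nsub sim]] := simplexP Tn0 simT.
have Zs : Z (x s) by have [i ->] := pcomb_head x sT nsub.
have [-> //|us] := eqVneq u s.
apply: (IHm (T :\ s)) => //; last by rewrite !inE us.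
  by apply: leq_trans leTm; rewrite [X in (_ < X)%N](cardsD1 s) sT.
move=> i j; have := ZT i j; rewrite (pcombD1 _ sT) !mxE => Zij.
(* [Z] is only known to be closed under differences, so zero is written as [x s - x s] in the
   subtracted term. *)
have -> : pcomb (T :\ s) x i j =
  x s * (s i == j)%:R + pcomb (T :\ s) x i j - (if s i == j then x s else x s - x s).
  by case: eqP => _; rewrite ?mulr1 ?mulr0 ?subrr; ring.
by apply: (ZB _ _ Zij); case: eqP => // _; apply: (ZB).
Qed.

(** * The span of the permutation matrices *)

Definition pspan (d : nat) (T : {set 'S_d}) : {vspace 'M[rat]_d} :=
  (\sum_(s in T) <[perm_mx s]>)%VS.

Lemma pspanP (d : nat) (T : {set 'S_d}) A :
  reflect (exists x, A = pcomb T x) (A \in pspan T).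
Proof.
apply: (iffP memv_sumP) => [[us us_in ->]|[x ->]]; last first.
  by exists (fun s => x s *: perm_mx s) => // s _; apply: memvZ; apply: memv_line.
have /fin_all_exists[x xP] s : exists x, s \in T -> us s = x *: perm_mx s.
  have [sT|_] := boolP (s \in T); last by exists 0.
  by have /vlineP[x ->] := us_in s sT; exists x.
by exists x; apply: eq_bigr => s /xP.
Qed.

Lemma pspanS (d : nat) (T T' : {set 'S_d}) : T \subset T' -> (pspan T <= pspan T')%VS.
Proof.
move=> /subsetP sTT'; apply/subv_sumP => s /sTT' sT'.
exact: (sumv_sup s).
Qed.

Lemma simplex_coef0 (d : nat) (T : {set 'S_d}) x :
  simplex T -> pcomb T x = 0 -> {in T, forall s, x s = 0}.
Proof.
move=> simT e; apply: (@simplex_coef_closed _ _ _ (fun a => a = 0)) => //.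
  by move=> a b -> ->; rewrite subrr.
by move=> i j; rewrite e mxE.
Qed.

Lemma simplex_coef_inj (d : nat) (T : {set 'S_d}) x y :
  simplex T -> pcomb T x = pcomb T y -> {in T, x =1 y}.
Proof.
move=> simT e s sT; apply/eqP; rewrite -subr_eq0; apply/eqP.
apply: (@simplex_coef0 _ _ (fun s => x s - y s) simT) => //.
rewrite /pcomb; under eq_bigr do rewrite scalerBl; rewrite sumrB.
by apply/eqP; rewrite subr_eq0; apply/eqP.
Qed.

Lemma dim_pspan_simplex (d : nat) (T : {set 'S_d}) : (0 < d)%N ->
  simplex T -> \dim (pspan T) = #|T|.
Proof.
move=> d_gt0 simT.
have /directvP/= -> : directv (pspan T).
  apply/directv_sum_independent => us us_in us0 s sT.
  have /fin_all_exists[x xP] u : exists x, u \in T -> us u = x *: perm_mx u.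
    have [uT|_] := boolP (u \in T); last by exists 0.
    by have /vlineP[x ->] := us_in u uT; exists x.
  rewrite xP // (@simplex_coef0 _ T x) ?scale0r // -us0.
  by apply: eq_bigr => u /xP.
rewrite -sum1_card; apply: eq_bigr => s _; rewrite dim_vline.
case: eqP => // /matrixP/(_ (Ordinal d_gt0) (s (Ordinal d_gt0))).
by rewrite !mxE eqxx => /eqP; rewrite oner_eq0.
Qed.

Lemma line_sums_pspan (d : nat) (A : 'M[rat]_d) : A \in pspan setT ->
  exists k, line_sums k A.
Proof. by move=> /pspanP[x ->]; eexists; apply: line_sums_pcomb. Qed.

(** Adding a large constant matrix makes any such matrix nonnegative, and both the sum and the
    constant matrix have greedy decompositions. *)
Lemma pspan_line_sums (n : nat) (k : rat) (A : 'M[rat]_n.+1) :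
  line_sums k A -> A \in pspan setT.
Proof.
have pos r (B : 'M[rat]_n.+1) :
    (forall i j, 0 <= B i j) -> line_sums r B -> B \in pspan setT.
  move=> B_ge0 /(greedy_exists B_ge0)[T [x [_ _ ->]]].
  by apply: (subvP (pspanS (subsetT T))); apply/pspanP; exists x.
move=> [rowA colA].
pose c := \sum_i \sum_j `|A i j|.
have c_ge0 : 0 <= c by apply: sumr_ge0 => i _; apply: sumr_ge0.
have c_le i j : `|A i j| <= c.
  rewrite /c (bigD1 i) //= (bigD1 j) //= -addrA lerDl addr_ge0 ?sumr_ge0 // => l _.
  by rewrite sumr_ge0.
have sum_const : line_sums (c *+ n.+1) (const_mx c : 'M_n.+1).
  by split=> i; under eq_bigr do rewrite mxE; rewrite sumr_const card_ord.
rewrite -[A](addrK (const_mx c)); apply: memvB.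
  apply: (pos (k + c *+ n.+1)) => [i j|].
    by rewrite !mxE; have := c_le i j; rewrite ler_norml => /andP[]; lra.
  split=> i; under eq_bigr do rewrite !mxE; rewrite big_split /= sumr_const card_ord.
    by rewrite rowA.
  by rewrite colA.
by apply: pos sum_const => i j; rewrite mxE.
Qed.

(** Coordinates on the space of matrices with constant line sums: the block without the first row
    and column, which may be chosen freely, and the common line sum. *)
Definition corner_sum (n : nat) (A : 'M[rat]_n.+1) : 'rV[rat]_(n * n + 1) :=
  row_mx (mxvec (row' ord0 (col' ord0 A))) (\sum_j A ord0 j)%:M.

Lemma corner_sum_linear (n : nat) : linear (@corner_sum n).
Proof.
move=> a A B; rewrite /corner_sum scale_row_mx add_row_mx; congr row_mx.
  by rewrite !linearP.
apply/matrixP=> i j; rewrite !ord1 !mxE /= !mulr1n mulr_sumr -big_split /=.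
by apply: eq_bigr => l _; rewrite !mxE.
Qed.

HB.instance Definition _ (n : nat) :=
  GRing.isLinear.Build rat _ _ _ (@corner_sum n) (@corner_sum_linear n).

Lemma dim_pspan_setT (n : nat) : \dim (pspan [set: 'S_n.+1]) = (n ^ 2 + 1)%N.
Proof.
pose L := pspan [set: 'S_n.+1].
pose g := linfun (@corner_sum n).
(* Injectivity: if the block and the line sum vanish, so do the other entries of the first row and
   column, the corner last. *)
have <- : \dim (g @: L) = \dim L.
  apply: limg_dim_eq; apply/eqP; rewrite -subv0; apply/subvP=> A.
  rewrite memv_cap memv_ker lfunE /= => /andP[/line_sums_pspan[k [rowA colA]]].
  rewrite -[0]row_mx0 => /eqP/eq_row_mx[/eqP]; rewrite mxvec_eq0 => /eqP/matrixP B0.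
  move=> /matrixP/(_ ord0 ord0); rewrite !mxE /= mulr1n rowA => k0.
  have B0' i j : A (lift ord0 i) (lift ord0 j) = 0 by have := B0 i j; rewrite !mxE.
  have r0 i : A (lift ord0 i) ord0 = 0.
    by have := rowA (lift ord0 i); rewrite big_ord_recl big1 ?addr0 ?k0.
  have c0 j : A ord0 (lift ord0 j) = 0.
    by have := colA (lift ord0 j); rewrite big_ord_recl big1 ?addr0 ?k0.
  have A00 : A ord0 ord0 = 0.
    by have := rowA ord0; rewrite big_ord_recl big1 ?addr0 ?k0.
  rewrite memv0; apply/eqP/matrixP=> i j; rewrite mxE.
  by case: (unliftP ord0 i) => [i'|] ->; case: (unliftP ord0 j) => [j'|] ->.
have -> : (g @: L)%VS = fullv; last by rewrite dimvf dim_matrix mul1r mulnn.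
apply/eqP; rewrite eqEsubv subvf; apply/subvP=> u _.
pose B := vec_mx (lsubmx u) : 'M[rat]_n.
pose r := rsubmx u ord0 ord0.
(* Surjectivity: the first row and column complete the block [B] to line sum [r]. The corner is
   defined from its row; it also fits its column, by exchanging the two sums over [B]. *)
pose A := \matrix_(i, j)
  match unlift ord0 i, unlift ord0 j with
  | Some i', Some j' => B i' j'
  | Some i', None => r - \sum_j' B i' j'
  | None, Some j' => r - \sum_i' B i' j'
  | None, None => r - \sum_j' (r - \sum_i' B i' j')
  end : 'M[rat]_n.+1.
have A00 : A ord0 ord0 = r - \sum_j' (r - \sum_i' B i' j') by rewrite mxE unlift_none.
have A0l j : A ord0 (lift ord0 j) = r - \sum_i' B i' j by rewrite mxE unlift_none liftK.
have Al0 i : A (lift ord0 i) ord0 = r - \sum_j' B i j' by rewrite mxE unlift_none liftK.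
have All i j : A (lift ord0 i) (lift ord0 j) = B i j by rewrite mxE !liftK.
have rowA i : \sum_j A i j = r.
  rewrite big_ord_recl; case: (unliftP ord0 i) => [i'|] ->.
    by rewrite Al0 [X in _ + X](eq_bigr (B i')) ?subrK // => j _; rewrite All.
  by rewrite A00 [X in _ + X](eq_bigr (fun j => r - \sum_i' B i' j)) ?subrK // => j _;
    rewrite A0l.
have colA j : \sum_i A i j = r.
  rewrite big_ord_recl; case: (unliftP ord0 j) => [j'|] ->.
    by rewrite A0l [X in _ + X](eq_bigr (B ^~ j')) ?subrK // => i _; rewrite All.
  rewrite A00 [X in _ + X](eq_bigr (fun i => r - \sum_j' B i j')) => [|i _]; last by rewrite Al0.
  by rewrite !sumrB exchange_big subrK.
have -> : u = g A.
  rewrite lfunE /= /corner_sum -[LHS]hsubmxK; congr row_mx.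
    by rewrite -[LHS]vec_mxK; congr mxvec; apply/matrixP=> i j; rewrite [RHS]mxE [RHS]mxE All.
  by apply/matrixP=> i j; rewrite !ord1 [RHS]mxE /= mulr1n rowA.
by apply: memv_img; apply: (pspan_line_sums (k := r)).
Qed.

(** * Generic perturbations *)

(** If [w] lies in [U], then so does [u] as soon as one combination does. If not, at most one [e]
    puts [u + e *: w] into [U], and the bound stays below it when it is positive. *)
Lemma small_avoid (vT : vectType rat) (u w : vT) (Us : seq {vspace vT}) :
  exists2 e0 : rat, 0 < e0 &
    forall e, 0 < e <= e0 -> forall U, U \in Us -> u + e *: w \in U -> u \in U /\ w \in U.
Proof.
elim: Us => [|U Us [e0 e0_gt0 IH]]; first by exists 1.
suff [e1 e1_gt0 He1] : exists2 e1 : rat, 0 < e1 &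
    forall e, 0 < e <= e1 -> u + e *: w \in U -> u \in U /\ w \in U.
  exists (Num.min e0 e1) => [|e]; first by rewrite lt_min e0_gt0.
  rewrite le_min => /andP[e_gt0 /andP[le0 le1]] U'; rewrite inE => /predU1P[->|].
    by apply: He1; rewrite e_gt0.
  by apply: IH; rewrite e_gt0.
have [wU|wU] := boolP (w \in U).
  exists 1 => // e _ uw; split=> //.
  by rewrite -[u](addrK (e *: w)) memvB ?memvZ.
have [/memv_addP[x xU [y /vlineP[c ->] defu]]|nu] := boolP (u \in (U + <[w]>)%VS); last first.
  exists 1 => // e _ uw; case/negP: nu.
  by rewrite -[u](addrK (e *: w)) memv_add // rpredN memvZ ?memv_line.
have bad e : u + e *: w \in U -> e = - c.
  rewrite defu -addrA -scalerDl => xw; apply/eqP; rewrite -addr_eq0 addrC.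
  apply: contraNT wU => ce.
  have cw : (c + e) *: w \in U by rewrite -[_ *: w](addKr x) memvD ?rpredN.
  by rewrite -[w]scale1r -(mulVf ce) -scalerA memvZ.
have [c_ge0|c_lt0] := leP 0 c.
  by exists 1 => // e /andP[e_gt0 _] /bad e_c; lra.
by exists (- c / 2) => [|e /andP[e_gt0 le_e] /bad e_c]; lra.
Qed.

Lemma small_scale (I : finType) (f : I -> rat) :
  exists2 e0 : rat, 0 < e0 & forall e, 0 < e <= e0 -> forall i, `|e * f i| < 1.
Proof.
pose B := 1 + \sum_i `|f i|.
have B_gt0 : 0 < B by rewrite ltr_pwDl // sumr_ge0.
exists B^-1 => [|e /andP[e_gt0 le_e] i]; first by rewrite invr_gt0.
rewrite normrM gtr0_norm //; have ltB : `|f i| < B.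
  by rewrite /B (bigD1 i) //=; have : 0 <= \sum_(j | j != i) `|f j| by [apply: sumr_ge0]; lra.
apply: le_lt_trans (ler_wpM2r (normr_ge0 _) le_e) _.
by rewrite mulrC ltr_pdivrMr ?mul1r.
Qed.

Definition generic (d : nat) (w : 'M[rat]_d) : Prop :=
  w \in pspan setT /\ forall T, w \in pspan T -> (pspan setT <= pspan T)%VS.

Lemma genericN (d : nat) (w : 'M[rat]_d) : generic w -> generic (- w).
Proof. by case=> w_in gen; split=> [|T]; rewrite rpredN //; apply: gen. Qed.

Lemma perm_mx_pspan (d : nat) (T : {set 'S_d}) s : s \in T -> perm_mx s \in pspan T.
Proof. by move=> sT; apply: subvP (sumv_sup s sT (subvv _)) _ (memv_line _). Qed.

(** Permutation matrices are added one at a time with small positive factors. By [small_avoid] the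
    new sum lies in [pspan T] only if the old sum and the new permutation do, so the final sum
    forces all permutations into [pspan T]. *)
Lemma generic_exists (n : nat) :
  exists2 v : 'M[rat]_n.+1, generic v & forall i j, 0 < v i j.
Proof.
have [v [v_ge0 v_gt0 v_in gen]] : exists v : 'M[rat]_n.+1, [/\ forall i j, 0 <= v i j,
    {in enum 'S_n.+1, forall (s : 'S_n.+1) i, 0 < v i (s i)}, v \in pspan setT &
    forall T, v \in pspan T -> {in enum 'S_n.+1, forall s, perm_mx s \in pspan T}].
  elim: (enum 'S_n.+1) => [|s r [v [v_ge0 v_gt0 v_in gen]]].
    by exists 0; split=> //; rewrite ?mem0v // => i j; rewrite mxE.
  have [e e_gt0 avoid] := small_avoid v (perm_mx s) [seq pspan T | T in {set 'S_n.+1}].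
  have E i j : (v + e *: perm_mx s) i j = v i j + e * (s i == j)%:R by rewrite !mxE.
  exists (v + e *: perm_mx s); split.
  - by move=> i j; rewrite E addr_ge0 // mulr_ge0 // ltW.
  - move=> u; rewrite inE => /predU1P[->|ur] i; rewrite E.
      by rewrite eqxx mulr1 ltr_wpDl.
    by rewrite ltr_pwDl ?v_gt0 // mulr_ge0 // ltW.
  - by rewrite memvD ?memvZ ?perm_mx_pspan ?inE.
  - move=> T vT; have [||vT' sT] := avoid e _ (pspan T) _ vT.
    + by rewrite e_gt0 lexx.
    + by apply/imageP; exists T.
    by move=> u; rewrite inE => /predU1P[->|] //; apply: gen.
exists v.
  split=> // T vT; apply/subv_sumP => s _; rewrite -memvE.
  by apply: gen; rewrite ?mem_enum.
(* Every entry lies on the graph of a permutation: [tperm i j] sends [i] to [j]. *)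
by move=> i j; have := v_gt0 (tperm i j); rewrite mem_enum => /(_ isT i); rewrite tpermL.
Qed.

Definition full (d : nat) (T : {set 'S_d}) : bool :=
  simplex T && (pspan setT <= pspan T)%VS.

Lemma card_full (n : nat) (T : {set 'S_n.+1}) : full T -> #|T| = (n ^ 2 + 1)%N.
Proof.
case/andP=> simT sub; rewrite -dim_pspan_setT -dim_pspan_simplex //; congr (\dim _).
by apply/eqP; rewrite eqEsubv sub pspanS ?subsetT.
Qed.

(** A vanishing coordinate at [s] would put [w] into the span of [T :\ s]; being generic, [w] would
    make this set spanning, against the independence of [T]. *)
Lemma generic_coords (d : nat) (w : 'M[rat]_d) : generic w ->
  exists b : {set 'S_d} -> 'S_d -> rat, forall T, full T ->
    w = pcomb T (b T) /\ {in T, forall s, b T s != 0}.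
Proof.
case=> w_in gen.
suff /fin_all_exists[b bP] (T : {set 'S_d}) : exists b : 'S_d -> rat, full T ->
    w = pcomb T b /\ {in T, forall s, b s != 0} by exists b.
have [/andP[simT sub]|nfull] := boolP (full T); last by exists (fun=> 0) => fullT;
  case/negP: nfull.
have /pspanP[b defw] := subvP sub _ w_in; exists b => _; split=> // s sT.
apply/eqP=> bs0.
have w_in' : w \in pspan (T :\ s).
  by apply/pspanP; exists b; rewrite defw (pcombD1 _ sT) bs0 scale0r add0r.
have /pspanP[x defs] := subvP (gen _ w_in') _ (perm_mx_pspan (in_setT s)).
(* Two expansions of [perm_mx s] over [T], with coefficients 0 and 1 at [s]. *)
have eqs : pcomb T (fun u => if u == s then 0 else x u) = pcomb T (fun u => (u == s)%:R).
  rewrite !(pcombD1 _ sT) eqxx scale0r scale1r add0r [X in _ = _ + X]big1 ?addr0.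
    rewrite defs; apply: eq_bigr => u; rewrite !inE => /andP[/negPf-> //].
  by move=> u; rewrite !inE => /andP[/negPf->]; rewrite scale0r.
by have /eqP := simplex_coef_inj simT eqs sT; rewrite !eqxx eq_sym oner_eq0.
Qed.

(** * Counting by half-open simplices *)

(** The sign condition says that [A + e w] is still nonnegative for small [e > 0]. *)
Definition signed_squares (d : nat) (w : 'M[rat]_d) (k : nat) : {set 'M['I_k.+1]_d} :=
  [set A : 'M['I_k.+1]_d | magic_square k (map_mx val A) &
     [forall i, forall j, (w i j < 0) ==> (0 < A i j)%N]].

(** Lattice points of a half-open simplex: when [b] has no zero on [T], the numbers [c s + e * b s]
    are positive there for small [e > 0]. *)
Definition signed_coefs (d : nat) (T : {set 'S_d}) (b : 'S_d -> rat) (k : nat) :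
    {set {ffun 'S_d -> 'I_k.+1}} :=
  [set c : {ffun 'S_d -> 'I_k.+1} | [&& (\sum_s c s == k)%N,
     [forall s, (s \notin T) ==> (c s == ord0)] &
     [forall s in T, (b s < 0) ==> (0 < c s)%N]]].

Lemma signed_shift_gt0 (e b : rat) (c : nat) : 0 < e -> b != 0 -> `|e * b| < 1 ->
  (b < 0 -> (0 < c)%N) -> 0 < c%:R + e * b.
Proof.
move=> e_gt0 b0; rewrite ltr_norml => /andP[le1 _] pos.
have [b_lt0|b_ge0] := ltP b 0.
  by have : 1 <= c%:R :> rat by [rewrite ler1n pos]; lra.
by rewrite ltr_wpDl // mulr_gt0 // lt_neqAle eq_sym b0.
Qed.

(** An integer above -1 is nonnegative; it cannot be 0 when [b] is negative, as [e * b] alone is not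
    positive. *)
Lemma shift_int_ge0 (e b x : rat) : x \is a Num.int -> `|e * b| < 1 ->
  0 < x + e * b -> 0 < e -> 0 <= x /\ (b < 0 -> 0 < x).
Proof.
move=> /intrP[m ->]; rewrite ltr_norml => /andP[_ lt1] pos e_gt0.
have m_ge0 : 0 <= m.
  have : -1 < m%:~R :> rat by lra.
  by rewrite -[-1](rmorphN1 (intmul 1)) ltr_int; lia.
split=> [|b_lt0]; first by rewrite ler0z.
rewrite ltr0z lt_neqAle m_ge0 andbT; apply: contraTneq pos => <-.
by rewrite add0r -leNgt pmulr_rle0 // ltW.
Qed.

(** A pair [(T, c)] gives the square with coefficients [c] on [T]; conversely, [T] is the greedy
    simplex of [A + e w], and [c] its coefficients less those of [e w]. *)
Lemma card_signed_squares (n : nat) (w : 'M[rat]_n.+1) b k :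
  generic w ->
  (forall T, full T -> w = pcomb T (b T) /\ {in T, forall s, b T s != 0}) ->
  #|signed_squares w k| = (\sum_(T | full T) #|signed_coefs T (b T) k|)%N.
Proof.
move=> [w_in gen] bP.
pose P := [set p : {set 'S_n.+1} * {ffun 'S_n.+1 -> 'I_k.+1} |
             full p.1 && (p.2 \in signed_coefs p.1 (b p.1) k)].
have -> : (\sum_(T | full T) #|signed_coefs T (b T) k| = #|P|)%N.
  under eq_bigr do rewrite -sum1_card.
  rewrite pair_big_dep -sum1_card /=; by apply: eq_bigl => p; rewrite [RHS]inE.
have [e1 e1_gt0 e1P] := small_scale (fun p : {set 'S_n.+1} * 'S_n.+1 => b p.1 p.2).
have [e2 e2_gt0 e2P] := small_scale (fun p : 'I_n.+1 * 'I_n.+1 => w p.1 p.2).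
pose e0 := Num.min e1 e2.
have e0_gt0 : 0 < e0 by rewrite lt_min e1_gt0.
have smallb e T s : 0 < e <= e0 -> `|e * b T s| < 1.
  by rewrite le_min => /and3P[e_gt0 le1 _]; apply: (e1P e _ (T, s)); rewrite e_gt0.
have smallw e i j : 0 < e <= e0 -> `|e * w i j| < 1.
  by rewrite le_min => /and3P[e_gt0 _ le2]; apply: (e2P e _ (i, j)); rewrite e_gt0.
(* For a pair in [P] no entry exceeds the total [k] of the coefficients, so [inord] does not take
   its default value. *)
pose toM (c : {ffun 'S_n.+1 -> 'I_k.+1}) : 'M['I_k.+1]_n.+1 :=
  \matrix_(i, j) inord (\sum_(s : 'S_n.+1 | s i == j) c s).
pose ratM (A : 'M['I_k.+1]_n.+1) : 'M[rat]_n.+1 := \matrix_(i, j) (A i j : nat)%:R.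
have PP p : p \in P -> [/\ full p.1, (\sum_s p.2 s = k)%N,
    forall s, s \notin p.1 -> p.2 s = ord0 &
    {in p.1, forall s, b p.1 s < 0 -> (0 < p.2 s)%N}].
  rewrite !inE => /and4P[fullT /eqP sumc /forallP c0 /forall_inP c1]; split=> // s sT.
    by apply/eqP; apply: (implyP (c0 s)).
  exact: (implyP (c1 s sT)).
have ratME p : p \in P -> ratM (toM p.2) = pcomb p.1 (fun s => (p.2 s : nat)%:R).
  move=> /PP[_ sumc c0 _]; apply/matrixP=> i j; rewrite pcombE !mxE inordK.
    rewrite natr_sum [RHS]big_mkcond [LHS]big_mkcond; apply: eq_bigr => s _ /=.
    by case: (boolP (s \in _)) => //= sT; rewrite c0 // if_same.
  by rewrite ltnS -[leqRHS]sumc [leqRHS](bigID (fun s : 'S_n.+1 => s i == j)) leq_addr.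
have shiftE p e : p \in P ->
    ratM (toM p.2) + e *: w = pcomb p.1 (fun s => (p.2 s : nat)%:R + e * b p.1 s).
  move=> pP; have [fullT _ _ _] := PP p pP; rewrite ratME //.
  rewrite {1}(bP _ fullT).1 /pcomb scaler_sumr -big_split; apply: eq_bigr => s _.
  by rewrite scalerDl scalerA.
have shift_gt0 p e : p \in P -> 0 < e <= e0 ->
    {in p.1, forall s, 0 < (p.2 s : nat)%:R + e * b p.1 s}.
  move=> pP le_e s sT; have [fullT _ _ c1] := PP p pP.
  apply: signed_shift_gt0; first by case/andP: le_e.
  - by have [_] := bP _ fullT; apply.
  - exact: smallb.
  - exact: c1.
have e00 : 0 < e0 <= e0 by rewrite e0_gt0 lexx.
have simP p : p \in P -> simplex p.1 by case/PP => /andP[].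
(* Shifting both combinations by the same [e0 *: w] makes all coefficients positive, so that
   [pcomb_inj] applies. *)
have inj : {in P &, injective (fun p => toM p.2)}.
  move=> [T c] [T' c'] pP pP' eM.
  have e_eq := shiftE _ e0 pP; rewrite eM (shiftE _ e0 pP') /= in e_eq.
  have [eT ec] := pcomb_inj (simP _ pP') (simP _ pP) (shift_gt0 _ _ pP' e00)
                  (shift_gt0 _ _ pP e00) e_eq.
  rewrite /= in eT ec; subst T'; congr pair; apply/ffunP=> s; apply: val_inj => /=.
  have [sT|sT] := boolP (s \in T).
    by have /addIr/eqP := ec s sT; rewrite eqr_nat => /eqP.
  have [_ _ c0 _] := PP _ pP; have [_ _ c0' _] := PP _ pP'.
  by rewrite (c0 s sT) (c0' s sT).
rewrite -(card_in_imset inj); apply: eq_card => A; apply/idP/imsetP => [|[p pP ->]]; last first.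
  have [fullT sumc c0 c1] := PP p pP.
  have [row col] := line_sums_pcomb p.1 (fun s => (p.2 s : nat)%:R : rat).
  have sumk : \sum_(s in p.1) (p.2 s : nat)%:R = k%:R :> rat.
    rewrite -[k in RHS]sumc natr_sum [LHS]big_mkcond; apply: eq_bigr => s _.
    by case: (boolP (s \in _)) => //= sT; rewrite c0.
  rewrite sumk -ratME // in row col.
  rewrite inE; apply/andP; split.
    apply/andP; split; apply/forallP => i; rewrite -(eqr_nat rat) natr_sum.
      by rewrite -[X in _ == X](row i); apply/eqP/eq_bigr => j _; rewrite !mxE.
    by rewrite -[X in _ == X](col i); apply/eqP/eq_bigr => j _; rewrite !mxE.
  apply/forallP=> i; apply/forallP=> j; apply/implyP => w_lt0.
  have : 0 <= (ratM (toM p.2) + e0 *: w) i j.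
    by rewrite shiftE // pcomb_ge0 // => s; apply: shift_gt0.
  rewrite !mxE; case: posnP => // ->; rewrite add0r => ?.
  by have := w_lt0; rewrite -(pmulr_rlt0 _ e0_gt0); lra.
rewrite inE => /andP[/andP[/forallP rowA /forallP colA] /forallP signA].
(* Unlike [e0], the bound [e3] depends on [A]; below it [A + e w] lies in no span that misses [w],
   which forces its simplex to be full. *)
have [e3 e3_gt0 avoid] := small_avoid (ratM A) w [seq pspan T | T : {set 'S_n.+1}].
pose e := Num.min e0 e3.
have e_gt0 : 0 < e by rewrite lt_min e0_gt0.
have le_e : 0 < e <= e0 by rewrite e_gt0 /e ge_min lexx.
have le_e3 : 0 < e <= e3 by rewrite e_gt0 /e ge_min lexx orbT.
have line_A : line_sums k%:R (ratM A).
  split=> i.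
    by rewrite -(eqP (rowA i)) natr_sum; apply: eq_bigr => j _; rewrite !mxE.
  by rewrite -(eqP (colA i)) natr_sum; apply: eq_bigr => j _; rewrite !mxE.
have [kw line_w] := line_sums_pspan w_in.
have [||T [x [simT x_gt0 defT]]] := @greedy_exists n (k%:R + e * kw) (ratM A + e *: w).
- move=> i j; rewrite !mxE; have [w_lt0|w_ge0] := ltP (w i j) 0.
    have /forallP/(_ j)/implyP/(_ w_lt0) A_gt0 := signA i.
    have : 1 <= (A i j : nat)%:R :> rat by rewrite ler1n.
    by have := smallw e i j le_e; rewrite ltr_norml => /andP[]; lra.
  by rewrite addr_ge0 // mulr_ge0 // ltW.
- case: line_A line_w => rA cA [rw cw]; split=> i; under eq_bigr do rewrite mxE [X in _ + X]mxE.
    by rewrite big_split /= rA -mulr_sumr rw.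
  by rewrite big_split /= cA -mulr_sumr cw.
have fullT : full T.
  rewrite /full simT /=; apply: gen.
  have [] // := avoid e le_e3 (pspan T); first by apply/imageP; exists T.
  by apply/pspanP; exists x.
have [defw b0] := bP T fullT.
pose y s := x s - e * b T s.
have defA : ratM A = pcomb T y.
  apply: (addIr (e *: w)); rewrite defT [in RHS]defw /pcomb scaler_sumr -big_split.
  by apply: eq_bigr => s _; rewrite /= scalerA -scalerDl /y subrK.
(* Unimodularity: the entries of [A] are integers. *)
have y_int : {in T, forall s, y s \is a Num.int}.
  apply: (@simplex_coef_closed _ _ _ (fun a => a \is a Num.int)) => //.
    by move=> a c; apply: rpredB.
  by move=> i j; rewrite -defA mxE.
have yP s : s \in T -> 0 <= y s /\ (b T s < 0 -> 0 < y s).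
  move=> sT; apply: (@shift_int_ge0 e (b T s)) => //; first exact: y_int.
    exact: smallb.
  by rewrite /y subrK x_gt0.
have sumy : \sum_(s in T) y s = k%:R.
  have [row _] := line_sums_pcomb T y; rewrite -(row ord0) -defA.
  by rewrite -(line_A.1 ord0).
have y_le s : s \in T -> y s <= k%:R.
  move=> sT; rewrite -sumy (bigD1 s) //= lerDl sumr_ge0 // => u /andP[uT _].
  by have [] := yP u uT.
pose c : {ffun 'S_n.+1 -> 'I_k.+1} := [ffun s => if s \in T then inord (Num.truncn (y s)) else ord0].
have cE s : s \in T -> (c s : nat)%:R = y s.
  move=> sT; have y_nat : y s \is a Num.nat by rewrite natrEint y_int //; have [] := yP s sT.
  rewrite ffunE sT inordK ?truncnK // ltnS -(ler_nat rat) truncnK //; exact: y_le.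
have pP : (T, c) \in P.
  rewrite !inE fullT /=; apply/and3P; split.
  - rewrite -(eqr_nat rat) natr_sum -sumy (bigID (mem T)) /= [X in _ + X]big1 ?addr0.
      by apply/eqP/eq_bigr.
    by move=> s sT; rewrite ffunE (negPf sT).
  - by apply/forallP=> s; apply/implyP=> sT; rewrite ffunE (negPf sT).
  - apply/forall_inP=> s sT; apply/implyP=> b_lt0.
    by rewrite -(ltr_nat rat) cE //; apply: (yP s sT).2.
exists (T, c) => //=.
have : ratM A = ratM (toM c).
  by rewrite (ratME _ pP) defA; apply: eq_bigr => s sT /=; rewrite cE.
move=> /matrixP eqA; apply/matrixP=> i j; apply: val_inj.
by have /eqP := eqA i j; rewrite 2![ratM _ _ _]mxE eqr_nat => /eqP.
Qed.

Definition neg_count (d : nat) (T : {set 'S_d}) (b : 'S_d -> rat) : nat :=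
  (\sum_(s in T) (b s < 0)%R)%N.

(** Lowering by one each coefficient that must be positive leaves [m.+1] natural numbers with sum
    [k - j], counted by stars and bars; there are none if [j > k]. *)
Lemma card_signed_coefs (d m : nat) (T : {set 'S_d}) (b : 'S_d -> rat) k :
  #|T| = m.+1 ->
  #|signed_coefs T b k| =
    (if neg_count T b <= k then 'C(k - neg_count T b + m, m) else 0)%N.
Proof.
move=> cardT; set j := neg_count T b.
have cP c : c \in signed_coefs T b k -> [/\ (\sum_(s in T) c s = k)%N,
    forall s, s \notin T -> c s = ord0 & {in T, forall s, ((b s < 0)%R <= c s)%N}].
  rewrite inE => /and3P[/eqP sumc /forallP c0 /forall_inP c1]; split.
  - rewrite -[RHS]sumc [LHS]big_mkcond; apply: eq_bigr => s _.
    by case: (boolP (s \in T)) => // sT; rewrite (eqP (implyP (c0 s) sT)).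
  - by move=> s sT; apply/eqP; apply: (implyP (c0 s)).
  - by move=> s /c1; case: (b s < 0)%R.
case: leqP => [le_jk|lt_kj]; last first.
  apply/eqP; rewrite cards_eq0; apply/eqP/setP=> c; rewrite [RHS]inE; apply/negP.
  move=> /cP[sumc _ c1]; have : (j <= \sum_(s in T) c s)%N by apply: leq_sum.
  by rewrite sumc leqNgt lt_kj.
pose K := (k - j)%N.
rewrite -[(k - j)%N]/K addnC -card_ord_partitions.
have [s0 s0T] : exists s, s \in T by apply/set0Pn; rewrite -card_gt0 cardT.
pose ix s := index s (enum T); pose en i := nth s0 (enum T) i.
have sizeT : size (enum T) = m.+1 by rewrite -cardE.
have ixK s : s \in T -> en (ix s) = s by move=> sT; rewrite /en nth_index ?mem_enum.
have enK i : (i < m.+1)%N -> ix (en i) = i.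
  by move=> lt_i; rewrite /ix index_uniq ?enum_uniq ?sizeT.
have enT i : (i < m.+1)%N -> en i \in T by move=> lt_i; rewrite -mem_enum mem_nth ?sizeT.
have sumT (F : 'S_d -> nat) : (\sum_(s in T) F s = \sum_(i < m.+1) F (en i))%N.
  by rewrite -big_enum (big_nth s0) sizeT big_mkord.
have sumt (t : m.+1.-tuple 'I_K.+1) :
    (\sum_(i <- t) i = \sum_(s in T) nth ord0 t (ix s))%N.
  rewrite sumT (big_nth ord0) size_tuple big_mkord; apply: eq_bigr => i _.
  by rewrite enK.
pose f (t : m.+1.-tuple 'I_K.+1) : {ffun 'S_d -> 'I_k.+1} :=
  [ffun s => if s \in T then inord (nth ord0 t (ix s) + (b s < 0)%R) else ord0].
have sum_shift (t : m.+1.-tuple 'I_K.+1) : (\sum_(i <- t) i = K)%N ->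
    (\sum_(s in T) (nth ord0 t (ix s) + (b s < 0)%R) = k)%N.
  by move=> sK; rewrite big_split -sumt /= sK /K subnK.
have fE (t : m.+1.-tuple 'I_K.+1) s : (\sum_(i <- t) i = K)%N -> s \in T ->
    f t s = (nth ord0 t (ix s) + (b s < 0)%R)%N :> nat.
  move=> /sum_shift sk sT; rewrite ffunE sT inordK // ltnS -[leqRHS]sk.
  by rewrite [leqRHS](bigD1 s) //= leq_addr.
rewrite -(@card_in_imset _ _ f) => [|t t'].
  apply/eq_card => c; apply/idP/imsetP => [/cP[sumc c0 c1]|[t]]; last first.
    rewrite inE => /eqP sK ->; rewrite inE; apply/and3P; split.
    - rewrite (bigID (mem T)) /= [X in (_ + X)%N]big1 ?addn0.
        by rewrite (eq_bigr _ (fun s => fE t s sK)) sum_shift.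
      by move=> s sT; rewrite ffunE (negPf sT).
    - by apply/forallP=> s; apply/implyP=> sT; rewrite ffunE (negPf sT).
    - by apply/forall_inP=> s sT; apply/implyP=> b_lt0; rewrite fE // b_lt0 addn1.
  have sumK : (\sum_(s in T) (c s - (b s < 0)%R) = K)%N.
    apply: (@addIn j); rewrite {1}/j /neg_count -big_split /K subnK // -[RHS]sumc.
    by apply: eq_bigr => s sT /=; rewrite subnK ?c1.
  have le_K s : s \in T -> (c s - (b s < 0)%R < K.+1)%N.
    by move=> sT; rewrite ltnS -sumK [leqRHS](bigD1 s) //= leq_addr.
  pose t := [tuple inord (c (en i) - (b (en i) < 0)%R) | i < m.+1] : m.+1.-tuple 'I_K.+1.
  have tE s : s \in T -> nth ord0 t (ix s) = (c s - (b s < 0)%R)%N :> nat.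
    move=> sT; have lt_ix : (ix s < m.+1)%N by rewrite -sizeT index_mem mem_enum.
    by rewrite -[ix s]/(nat_of_ord (Ordinal lt_ix)) -tnth_nth tnth_mktuple /= ixK // inordK ?le_K.
  have sK : (\sum_(i <- t) i = K)%N by rewrite sumt (eq_bigr _ tE).
  exists t; first by rewrite inE sK.
  apply/ffunP=> s; apply: val_inj => /=; have [sT|sT] := boolP (s \in T).
    by rewrite fE // tE // subnK ?c1.
  by rewrite ffunE (negPf sT) c0.
rewrite !inE => /eqP sK /eqP sK' /ffunP ef; apply: eq_from_tnth => i; apply: val_inj.
rewrite /= !(tnth_nth ord0) -(enK i) //; apply: (@addIn (b (en i) < 0)%R).
by rewrite -!fE ?enT // ef.
Qed.

(** * Polynomiality and reciprocity *)

(** The polynomial ['C(x + m, m)] in [x], with zeros at [-1, ..., -m]. *)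
Definition binpoly (m : nat) : {poly rat} :=
  (m`!%:R)^-1 *: \prod_(i < m) ('X + i.+1%:R%:P).

Lemma size_binpoly (m : nat) : (size (binpoly m) <= m.+1)%N.
Proof.
apply: leq_trans (size_scale_leq _ _) _.
rewrite size_prod => [|i _]; last by rewrite -size_poly_eq0 size_XaddC.
under eq_bigr do rewrite size_XaddC.
by rewrite sum_nat_const card_ord; lia.
Qed.

Lemma horner_binpoly (m : nat) (x : rat) :
  (binpoly m).[x] = (m`!%:R)^-1 * \prod_(i < m) (x + i.+1%:R).
Proof. by rewrite hornerZ horner_prod; under eq_bigr do rewrite !hornerE. Qed.

Lemma binpoly_nat (m c : nat) : (binpoly m).[c%:R] = 'C(c + m, m)%:R.
Proof.
have m0 : m`!%:R != 0 :> rat by rewrite pnatr_eq0 -lt0n fact_gt0.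
apply: (mulfI m0); rewrite horner_binpoly mulVKf // -natrM mulnC bin_ffact ffact_prod.
rewrite natr_prod (reindex_inj rev_ord_inj) /=; apply: eq_bigr => i _.
by rewrite -natrD; congr _%:R; have := ltn_ord i; lia.
Qed.

Lemma binpoly_neg (m i : nat) : (0 < i <= m)%N -> (binpoly m).[- i%:R] = 0.
Proof.
case: i => // i /= lt_im; rewrite horner_binpoly (bigD1 (Ordinal lt_im)) //=.
by rewrite addNr mul0r mulr0.
Qed.

(** The reflection turns each of the [m] factors into minus the factor counted from the other
    end. *)
Lemma binpoly_reciprocity (m : nat) (x : rat) :
  (binpoly m).[- x - m.+1%:R] = (-1) ^+ m * (binpoly m).[x].
Proof.
rewrite !horner_binpoly mulrCA; congr (_ * _).
rewrite (reindex_inj rev_ord_inj) /=.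
rewrite -[X in (-1) ^+ X](card_ord m) -prodrN; apply: eq_bigr => i _.
have -> : m.+1%:R = (m - i.+1).+1%:R + i.+1%:R :> rat.
  by rewrite -natrD; congr _%:R; have := ltn_ord i; lia.
by ring.
Qed.

(** The zeros of [binpoly m] account for the empty case, so one polynomial covers all
    [k >= j - m]. *)
Lemma binpoly_shift (m k j : nat) : (j <= k + m)%N ->
  (if (j <= k)%N then 'C(k - j + m, m) else 0)%N%:R = (binpoly m).[k%:R - j%:R].
Proof.
move=> le_j; case: leqP => [le_jk|lt_kj]; first by rewrite -natrB // binpoly_nat.
rewrite -[k%:R - _]opprB -natrB 1?ltnW // binpoly_neg //; lia.
Qed.

Lemma signed_squares_pos (d : nat) (w : 'M[rat]_d) k : (forall i j, 0 < w i j) ->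
  #|signed_squares w k| = magic_count d k.
Proof.
move=> w_gt0; apply: eq_card => A; rewrite !inE andbC.
have -> // : [forall i, forall j, (w i j < 0) ==> (0 < A i j)%N].
by apply/forallP=> i; apply/forallP=> j; rewrite ltNge ltW.
Qed.

(** All entries must be positive here, so lowering every entry by one takes [d] off each line
    sum. *)
Lemma signed_squares_neg (d : nat) (w : 'M[rat]_d) k : (0 < d)%N ->
  (forall i j, w i j < 0) -> #|signed_squares w (k + d)| = magic_count d k.
Proof.
move=> d_gt0 w_lt0.
pose f (A : 'M['I_k.+1]_d) : 'M['I_(k + d).+1]_d := \matrix_(i, j) inord (A i j).+1.
have fE A i j : f A i j = (A i j).+1 :> nat.
  by rewrite mxE inordK //; have := ltn_ord (A i j); lia.
clearbody f.
have sumS (F : 'I_d -> nat) : (\sum_i (F i).+1 = \sum_i F i + d)%N.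
  under eq_bigr do rewrite -addn1.
  by rewrite big_split /= sum_nat_const card_ord muln1.
rewrite /magic_count -(@card_in_imset _ _ f) => [|A A' _ _ eA]; last first.
  apply/matrixP=> i j; apply: val_inj; apply: succn_inj.
  by rewrite -!fE eA.
apply: eq_card => B; apply/idP/imsetP => [|[A]]; rewrite !inE; last first.
  case/andP=> /forallP rA /forallP cA ->; apply/andP; split.
    apply/andP; split; apply/forallP=> i; under eq_bigr do rewrite mxE /= fE.
      by rewrite sumS eqn_add2r; rewrite -[X in _ == X](eqP (rA i));
        apply/eqP/eq_bigr => j _; rewrite mxE.
    by rewrite sumS eqn_add2r; rewrite -[X in _ == X](eqP (cA i));
      apply/eqP/eq_bigr => j _; rewrite mxE.
  by apply/forallP=> i; apply/forallP=> j; rewrite fE implybT.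
case/andP=> /andP[/forallP rB /forallP cB] /forallP posB.
have B_gt0 i j : (0 < B i j)%N by have /forallP/(_ j) := posB i; rewrite w_lt0.
have rB' i : (\sum_j (B i j).-1 = k)%N.
  apply: (@addIn d); rewrite -sumS -[RHS](eqP (rB i)); apply: eq_bigr => j _.
  by rewrite mxE prednK.
have cB' j : (\sum_i (B i j).-1 = k)%N.
  apply: (@addIn d); rewrite -sumS -[RHS](eqP (cB j)); apply: eq_bigr => i _.
  by rewrite mxE prednK.
have lt_B i j : ((B i j).-1 < k.+1)%N.
  by rewrite ltnS -[leqRHS](rB' i) [leqRHS](bigD1 j) //= leq_addr.
exists (\matrix_(i, j) inord (B i j).-1).
  rewrite inE; apply/andP; split; apply/forallP=> i.
    under eq_bigr do rewrite !mxE /= inordK //.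
    by rewrite rB'.
  under eq_bigr do rewrite !mxE /= inordK //.
  by rewrite cB'.
apply/matrixP=> i j; apply: val_inj; rewrite /= fE mxE inordK //.
by rewrite prednK.
Qed.

(* Replacing [v] by [- v] exchanges the conditions [c_s >= 0] and [c_s >= 1], and
   this is exactly what [binpoly_reciprocity] does to the number of solutions. *)
Lemma magic_count_poly (n : nat) : exists P : {poly rat},
  [/\ (size P <= (n ^ 2).+1)%N,
      forall k : nat, (magic_count n.+1 k)%:R = P.[k%:R] &
      forall k : nat, P.[- (k + n.+1)%:R] = (-1) ^+ (n ^ 2) * P.[k%:R]].
Proof.
have [v gen_v v_gt0] := generic_exists n.
have [b bP] := generic_coords gen_v.
pose m := (n ^ 2)%N; pose j T := neg_count T (b T).
have cardT (T : {set 'S_n.+1}) : full T -> #|T| = m.+1.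
  by move=> fullT; rewrite card_full // addn1.
pose P : {poly rat} := \sum_(T | full T) (binpoly m \Po ('X - (j T)%:R%:P)).
have PE x : P.[x] = \sum_(T | full T) (binpoly m).[x - (j T)%:R].
  by rewrite horner_sum; apply: eq_bigr => T _; rewrite horner_comp !hornerE.
(* The line sums of [v] are positive and equal the sum of its coordinates on [T], so not all [m.+1]
   coordinates are negative. Thus [binpoly_shift] applies for every [k], starting from 0. *)
have le_jm T : full T -> (j T <= m)%N.
  move=> fullT; have [defv _] := bP T fullT.
  have [row _] := line_sums_pcomb T (b T).
  have [s sT bs] : exists2 s, s \in T & 0 <= b T s.
    apply/exists_inP; rewrite -[X in is_true X]negbK negb_exists_in; apply/negP.
    move=> /forall_inP neg; have : 0 < \sum_l v ord0 l.
      by rewrite big_ord_recl ltr_pwDl // sumr_ge0 // => l _; apply: ltW.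
    rewrite {1}defv row ltNge => /negP[]; rewrite -oppr_ge0 -sumrN sumr_ge0 // => s sT.
    by rewrite oppr_ge0 ltW // ltNge neg.
  rewrite -ltnS -(cardT T fullT) (cardsD1 s) sT add1n ltnS /j /neg_count (big_setD1 s) //=.
  by rewrite ltNge bs add0n -sum1_card leq_sum // => u _; apply: leq_b1.
have HP k : (magic_count n.+1 k)%:R = P.[k%:R].
  rewrite -(signed_squares_pos k v_gt0) (card_signed_squares k gen_v bP) natr_sum PE.
  apply: eq_bigr => T fullT; rewrite (card_signed_coefs _ _ (cardT T fullT)).
  by rewrite binpoly_shift // (leq_trans (le_jm T fullT)) ?leq_addl.
exists P; split=> // [|k].
  apply: leq_trans (size_sum _ _ _) _; apply/bigmax_leqP=> T _.
  by rewrite size_comp_poly2 ?size_binpoly // size_XsubC.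
have bPN T : full T -> - v = pcomb T (fun s => - b T s) /\ {in T, forall s, - b T s != 0}.
  move=> fullT; have [defv b0] := bP T fullT; split=> [|s sT]; last by rewrite oppr_eq0 b0.
  by rewrite {1}defv /pcomb -sumrN; apply: eq_bigr => s _; rewrite scaleNr.
have v_lt0 i l : (- v) i l < 0 by rewrite mxE oppr_lt0.
rewrite -HP -(signed_squares_neg k (ltn0Sn n) v_lt0).
rewrite (card_signed_squares _ (genericN gen_v) bPN) natr_sum PE mulr_sumr.
apply: eq_bigr => T fullT; rewrite (card_signed_coefs _ _ (cardT T fullT)).
(* No coordinate vanishes, so each of the [m.+1] is negative for exactly one of [v] and [- v]. *)
have jN : (neg_count T (fun s => - b T s)) = (m.+1 - j T)%N.
  rewrite -(cardT T fullT) -sum1_card /j /neg_count; apply: (@addIn (j T)).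
  rewrite subnK ?leq_sum // => [|s _]; last exact: leq_b1.
  rewrite -big_split; apply: eq_bigr => s sT /=.
  by have := (bP T fullT).2 s sT; rewrite oppr_lt0; case: ltgtP.
rewrite jN binpoly_shift; last by lia.
rewrite -binpoly_reciprocity natrB 1?leqW ?le_jm //; congr (_.[_]); rewrite -/m; ring.
Qed.

(** * Finite differences *)

Lemma size_sub_comp_XsubC1 (p : {poly rat}) :
  (size (p - (p \Po ('X - 1%:P)))%R <= (size p).-1)%N.
Proof.
have [/size1_polyC ->|p_gt1] := leqP (size p) 1.
  by rewrite comp_polyC subrr size_poly0.
have sz : size (p \Po ('X - 1%:P)) = size p by rewrite size_comp_poly2 // size_XsubC.
apply/leq_sizeP=> i; rewrite leq_eqVlt => /predU1P[<-|lt_i]; rewrite coefB.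
  rewrite -lead_coefE -sz -lead_coefE lead_coef_comp ?size_XsubC //.
  by rewrite lead_coefXsubC expr1n mulr1 subrr.
have le_i : (size p <= i)%N by rewrite -(ltn_predK p_gt1).
by rewrite !nth_default ?sz // subrr.
Qed.

(** Pascal's rule: the difference of order [D.+1] of [p] is the difference of order [D] of
    [p(x) - p(x - 1)], whose degree is lower. *)
Lemma finite_difference_eq0 (D : nat) (p : {poly rat}) (x : rat) : (size p <= D)%N ->
  \sum_(i < D.+1) (-1) ^+ i * 'C(D, i)%:R * p.[x - i%:R] = 0.
Proof.
elim: D p x => [|D IHD] p x le_pD.
  by move: le_pD; rewrite leqn0 size_poly_eq0 => /eqP->; rewrite big1 // => i _;
    rewrite horner0 mulr0.
rewrite -[RHS](IHD (p - (p \Po ('X - 1%:P))) x); last first.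
  by apply: leq_trans (size_sub_comp_XsubC1 p) _; lia.
pose F i := p.[x - i%:R].
have FE i : (p - (p \Po ('X - 1%:P))).[x - i%:R] = F i - F i.+1.
  by rewrite !hornerE horner_comp !hornerE /F -addn1 natrD opprD addrA.
under [RHS]eq_bigr do rewrite FE mulrBr.
rewrite sumrB big_ord_recl [X in _ = X - _](_ : _ =
  \sum_(i < D.+2) (-1) ^+ i * 'C(D, i)%:R * F i); last first.
  by rewrite [RHS]big_ord_recr /= bin_small // mulr0 mul0r addr0.
rewrite [in RHS]big_ord_recl !bin0 -addrA -sumrB; congr (_ + _); apply: eq_bigr => i _.
by rewrite /= /bump /= !add1n binS natrD exprS /F; ring.
Qed.

Local Close Scope ring_scope.

(** * The alternating sum as half of a finite difference *)

Theorem theorem6p6 (d : nat) (hd : 0 < d) (hev : ~~ odd d) :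
  let N := uphalf ((d - 1) ^ 2) in
  (\sum_(0 <= m < N.+1)
     (-1) ^+ (N + m) * 'C(d ^ 2 - 2 * d + 3, N - m)%:Z
       * (magic_count d (d * m))%:Z = 0 :> int)%R.
Proof.
case: d hd hev => // n _ even_d N.
have odd_n : odd n by move: even_d; rewrite /= negbK.
have odd_n2 : odd (n ^ 2) by rewrite oddX odd_n orbT.
have NE : N.*2 = (n ^ 2).+1.
  by rewrite /N subn1 uphalf_half odd_n2 -[in RHS](odd_double_half (n ^ 2)) odd_n2 doubleD.
(* Since [(d - 1) ^ 2] is odd, [2N = n ^ 2 + 1]; hence [D = n ^ 2 + 2], the upper index of the
   binomial coefficient, exceeds the degree bound of [P]. *)
pose D := N.*2.+1.
have -> : n.+1 ^ 2 - 2 * n.+1 + 3 = D by rewrite /D NE; nia.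
have [P [sizeP magicP recP]] := magic_count_poly n.
pose Q : {poly rat} := (P \Po (n.+1%:R *: 'X))%R.
have sizeQ : size Q <= D.
  rewrite size_comp_poly2; first by rewrite /D NE; apply: leq_trans sizeP _.
  by rewrite size_scale ?size_polyX // Num.Theory.pnatr_eq0.
have QE i : i <= N -> (Q.[N%:R - i%:R] = P.[(n.+1 * (N - i))%:R])%R.
  by move=> le_iN; rewrite horner_comp !hornerE natrM natrB.
pose a i : rat := ((-1) ^+ i * 'C(D, i)%:R * Q.[N%:R - i%:R])%R.
(* The index [D - i] evaluates [Q] at [-1 - (N - i)]. Reciprocity with odd exponent [n ^ 2] changes
   the sign of the value, and odd [D] changes the sign of the power of -1; the two cancel. *)
have symm i : i <= N -> a (D - i) = a i.
  move=> le_iN; have le_iD : i <= D by rewrite /D; lia.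
  rewrite /a bin_sub // -signr_odd oddB // /D /= odd_double /= -[in RHS]signr_odd.
  have -> : (Q.[N%:R - (N.*2.+1 - i)%:R] = - Q.[N%:R - i%:R])%R.
    have := recP (n.+1 * (N - i)); rewrite -signr_odd odd_n2 expr1 mulN1r -QE // => <-.
    rewrite horner_comp !hornerE natrD natrM !natrB //; congr (_.[_])%R.
    by rewrite -addnn -addn1 !natrD; ring.
  by case: (odd i); rewrite /= ?expr0 ?expr1; ring.
(* The [D.+1 = 2 * N.+1] terms form equal pairs [i], [D - i], so the first half already sums to
   zero. *)
have halves : (\sum_(i < N.+1) a i = 0)%R.
  have sum0 : (\sum_(i < D.+1) a i = 0)%R by apply: finite_difference_eq0.
  have DE : D.+1 = N.+1 + N.+1 by rewrite /D; lia.
  rewrite DE big_split_ord /= [X in (_ + X)%R](reindex_inj rev_ord_inj) /= in sum0.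
  rewrite [X in (_ + X)%R](eq_bigr (fun i : 'I_N.+1 => a i)) in sum0; last first.
    move=> i _; have le_iN : i <= N by rewrite -ltnS.
    by rewrite -(symm i) //; congr (a _); rewrite /D; lia.
  by apply/eqP; have /eqP := sum0; rewrite -mulr2n Num.Theory.mulrn_eq0.
apply/eqP; rewrite -(intr_eq0 rat); apply/eqP.
(* Reversing the order puts [m = N - i], and [(-1) ^+ (N + (N - i))] is [(-1) ^+ i]. *)
rewrite -[RHS]halves rmorph_sum /= big_mkord (reindex_inj rev_ord_inj) /=.
apply: eq_bigr => i _; have le_iN : i <= N by rewrite -ltnS.
rewrite !rmorphM rmorphXn rmorphN1 /= -!pmulrn /a QE // magicP subSS subKn //.
by rewrite -(signr_odd _ (N + (N - i))) oddD oddB // addKb signr_odd.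
Qed.
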